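(* Let $K$ be a group, let $(PQR): P\xrightarrow{\bar\jmath}Q\xrightarrow{\bar\phi}R$ be a group extension, let $\theta:Q\to\mathrm{Out}(K)$ be an outer action, and let $(KGQ)=(G,i,\pi)$ be an extension of $K$ by $Q$ with outer action $\theta$. Let $(KNP)=(N,i_0,\pi_0)$ be its $P$-subextension, $j:N\hookrightarrow G$ the canonical inclusion, and $\Theta:Q\to\mathrm{Out}(N;K)$ the mod-$K$ outer action of the iterated extension $(G,j,\pi)$ of $(KNP)$ by $(PQR)$. Then for any automorphism $\xi\in\mathrm{Aut}(KGQ)$, its restriction $\xi|_N$ to $N$ is a $\Theta$-compatible automorphism of the extension $(KNP)$. In other words, the homomorphism $\mathrm{Aut}(KGQ)\to\mathrm{Aut}(KNP)$, $\xi\mapsto\xi|_N$, maps $\mathrm{Aut}(KGQ)$ into $\mathrm{Aut}_\Theta(KNP)$, and the diagram $$\begin{array}{ccc}H^1(Q,Z(K))&\xrightarrow{\ \mathrm{res}\ }&H^1(P,Z(K))^R\\ {\scriptstyle-\star}\downarrow\simeq&&\simeq\downarrow{\scriptstyle-\star}\\ \mathrm{Out}(KGQ;K)&\longrightarrow&\mathrm{Out}_\Theta(KNP;K)\end{array}$$ commutes, where the bottom map is induced by $\xi\mapsto\xi|_N$ and the vertical isomorphisms are induced by $\lambda\mapsto(g\mapsto\lambda(\pi(g))\cdot g)$ for $\lambda\in Z^1(Q,Z(K))$ and by $\lambda\mapsto(n\mapsto\lambda(\pi_0(n))\cdot n)$ for $\lambda\in Z^1(P,Z(K))$.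
   Context: Conventions. For a group $H$ and an $H$-module $A$ (written multiplicatively), cochains are normalized; $Z^1(H,A)$ is the group of maps $\lambda$ with $\lambda(h_1h_2)=\lambda(h_1)\cdot{}^{h_1}\lambda(h_2)$, $B^1(H,A)=\{\partial a: h\mapsto a^{-1}\cdot{}^{h}a\}$, $H^1=Z^1/B^1$; $\mathrm{res}$ is restriction of cocycles. Extensions. An extension of $K$ by $Q$ is a triple $(G,i,\pi)$ with $i:K\to G$ an injective homomorphism, $\pi:G\to Q$ a surjective homomorphism, $i(K)=\mathrm{Ker}(\pi)$; $K$ is identified with $i(K)$, and $P$ with $\bar\jmath(P)\subseteq Q$. Conjugation of $G$ on $K$ induces a homomorphism $Q\to\mathrm{Out}(K)=\mathrm{Aut}(K)/\mathrm{Inn}(K)$, the outer action of the extension. The $P$-subextension of $(G,i,\pi)$ is the extension $(N,i_0,\pi_0)$ of $K$ by $P$ with $N:=\pi^{-1}(P)$ and $i_0,\pi_0$ induced by $i,\pi$. With $j:N\to G$ the inclusion, $(G,j,\pi)$ is an iterated extension of $(KNP)$ by $(PQR)$, i.e. $\pi\circ j=\bar\jmath\circ\pi_0$, $j(N)=\mathrm{Ker}(\bar\phi\circ\pi)$, $(j\circ i_0)(K)=\mathrm{Ker}(\pi)$. Actions. $Q$ acts on $Z(K)$ via $\theta$. $R$ acts on $H^1(P,Z(K))$ by ${}^r[\lambda]=[{}^q\lambda]$ for any $q\in Q$ with $\bar\phi(q)=r$, where ${}^q\lambda(p)={}^{\theta(q)}\lambda(q^{-1}pq)$. Mod-$K$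 outer actions. For a group $M$ containing $K$ as a normal subgroup, $\mathrm{Aut}_K(M)$ is the group of automorphisms of $M$ mapping $K$ onto $K$, $\complement_M(K)$ is its subgroup of inner automorphisms by elements of $K$, and $\mathrm{Out}(M;K):=\mathrm{Aut}_K(M)/\complement_M(K)$. The mod-$K$ outer action of the iterated extension $(G,j,\pi)$ is the homomorphism $\Theta:Q\to\mathrm{Out}(N;K)$ sending $\pi(g)$ to the class of the automorphism of $N$ given by conjugation by $g\in G$. Automorphisms. $\mathrm{Aut}(KGQ):=\{\xi\in\mathrm{Aut}(G):\xi\circ i=i,\ \pi\circ\xi=\pi\}$, and $\mathrm{Aut}(KNP)$ is defined likewise; $\mathrm{Out}(KGQ;K)$ is the image of $\mathrm{Aut}(KGQ)$ in $\mathrm{Out}(G;K)$. For $\xi\in\mathrm{Aut}(KGQ)$, $\xi|_N\in\mathrm{Aut}(KNP)$ is characterized by $j\circ\xi|_N=\xi\circ j$. An automorphism $\eta\in\mathrm{Aut}_K(N)$ is $\Theta$-compatible if its image in $\mathrm{Out}(N;K)$ commutes with $\Theta(q)$ for all $q\in Q$; $\mathrm{Aut}_\Theta(KNP)$ is the group of $\Theta$-compatible elements of $\mathrm{Aut}(KNP)$, and $\mathrm{Out}_\Theta(KNP;K)$ is its image in $\mathrm{Out}(N;K)$. *)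

(* Defs.v *)
From HB Require Import structures.
From mathcomp Require Import all_boot.
From mathcomp Require Import boolp classical_sets.

Set Implicit Arguments.
Unset Strict Implicit.
Unset Printing Implicit Defensive.

Local Open Scope group_scope.

(* Groups are arbitrary (possibly infinite) [groupType]s; their [choiceType]   *)
(* structure is no restriction since every type has one classically.           *)
(* Conjugation by [g] is always [x |-> g * x * g^-1], and automorphisms are    *)
(* multiplied by [(a * b) x = a (b x)].                                        *)
(*                                                                             *)
(* Correspondence with the usual notation, for an embedding [i : K -> M] with  *)
(* K identified with [range i], [G : extension K Q], [B : extension P R] whose *)
(* total group is Q, and [N := subextension G]:                                *)
(*   AutK i, innerK i, OutK i     Aut_K(M), its subgroup of inner              *)
(*                                automorphisms by elements of K, Out(M;K)     *)
(*   AutE G, OutE G               Aut(KGQ), Out(KGQ;K)                         *)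
(*   AutTheta T, OutTheta T       Aut_T(KNP), Out_T(KNP;K)                     *)
(*   AutE_restr xi                xi|_N                                        *)
(*   H1_module A, invariants      H^1(P,A) as an R-module, A a Q-module; A^H   *)

Section Homomorphisms.
Variables (G H : groupType) (f : {multiplicative G -> H}).

Lemma hom1 : f 1 = 1.
Proof. by apply: (mulgI (f 1)); rewrite -gmulfM !mulg1. Qed.

Lemma homV x : f x^-1 = (f x)^-1.
Proof. by apply: (mulgI (f x)); rewrite -gmulfM !mulgV hom1. Qed.

End Homomorphisms.

Section Subgroups.
Variables (G : groupType) (S : groupClosed G).

Record subg := Subg { subg_val : G; subg_valP : subg_val \in S }.

HB.instance Definition _ := [isSub for subg_val].
HB.instance Definition _ := [Choice of subg by <:].

Fact subg_closed : group_closed (fun x => x \in S).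
Proof.
by split=> [|x y xS yS]; [exact: (gpred1 (s := S)) | exact: (gpredF (S := S))].
Qed.

HB.instance Definition _ :=
  SubChoice_isSubGroup.Build G (fun x => x \in S) subg subg_closed.

Lemma valV (x : subg) : val x^-1 = (val x)^-1.
Proof. exact: (homV val). Qed.

End Subgroups.

HB.mixin Record isConjClosed (G : groupType) (S : {pred G}) := {
  gpredJr : forall x y : G, x \in S -> y * x * y^-1 \in S
}.

#[short(type="normalClosed")]
HB.structure Definition NormalClosed (G : groupType) :=
  {S of isConjClosed G S & GroupClosed G S}.

Section Quotients.
Variables (G : groupType) (H : normalClosed G).
Local Open Scope quotient_scope.

Definition coset_rel (x y : G) := x^-1 * y \in H.

Fact coset_rel_refl : reflexive coset_rel.
Proof. by move=> x; rewrite /coset_rel mulVg (gpred1 (s := H)). Qed.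

Fact coset_rel_sym : symmetric coset_rel.
Proof.
by move=> x y; rewrite /coset_rel -(gpredV H (x^-1 * y)) invgM invgK.
Qed.

Fact coset_rel_trans : transitive coset_rel.
Proof.
move=> y x z xy yz; rewrite /coset_rel.
have -> : x^-1 * z = (x^-1 * y) * (y^-1 * z) by rewrite mulgA mulgK.
exact: (gpredM (s := H)).
Qed.

Canonical coset_equiv :=
  EquivRel coset_rel coset_rel_refl coset_rel_sym coset_rel_trans.

Definition quotg := {eq_quot coset_equiv}.

HB.instance Definition _ := Quotient.on quotg.
HB.instance Definition _ := Choice.on quotg.

Definition qclass (x : G) : quotg := \pi_quotg x.

Lemma qclassP x y : qclass x = qclass y <-> x^-1 * y \in H.
Proof. by split=> [/eqmodP|xy]; [ | exact/eqmodP]. Qed.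

Lemma qclass_surj (c : quotg) : exists x, c = qclass x.
Proof. by exists (repr c); rewrite /qclass reprK. Qed.

Let mulq (c d : quotg) : quotg := qclass (repr c * repr d).
Let oneq : quotg := qclass 1.
Let invq (c : quotg) : quotg := qclass (repr c)^-1.

Lemma reprq x : x^-1 * repr (qclass x) \in H.
Proof. by apply/qclassP; rewrite /qclass reprK. Qed.

Let mulqE x y : mulq (qclass x) (qclass y) = qclass (x * y).
Proof.
apply/esym/qclassP; rewrite invgM.
set x' := repr _; set y' := repr _.
have -> : y^-1 * x^-1 * (x' * y')
    = (y^-1 * (x^-1 * x') * y^-1^-1) * (y^-1 * y').
  by rewrite invgK !mulgA mulgK.
by apply: (gpredM (s := H)); [apply: gpredJr; exact: reprq | exact: reprq].
Qed.

Let invqE x : invq (qclass x) = qclass x^-1.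
Proof.
apply/qclassP; rewrite invgK.
by have := gpredJr (s := H) _ x (reprq x); rewrite mulgA mulgV mul1g.
Qed.

Let mulqA : associative mulq.
Proof.
move=> c d e; case: (qclass_surj c) (qclass_surj d) (qclass_surj e).
by move=> x -> [y ->] [z ->]; rewrite !mulqE mulgA.
Qed.

Let mul1q : left_id oneq mulq.
Proof. by move=> c; case: (qclass_surj c) => x ->; rewrite mulqE mul1g. Qed.

Let mulq1 : right_id oneq mulq.
Proof. by move=> c; case: (qclass_surj c) => x ->; rewrite mulqE mulg1. Qed.

Let mulVq : left_inverse oneq invq mulq.
Proof.
by move=> c; case: (qclass_surj c) => x ->; rewrite invqE mulqE mulVg.
Qed.

Let mulqV : right_inverse oneq invq mulq.
Proof.
by move=> c; case: (qclass_surj c) => x ->; rewrite invqE mulqE mulgV.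
Qed.

HB.instance Definition _ := isGroup.Build quotg mulqA mul1q mulq1 mulVq mulqV.

Fact qclassM : {morph qclass : x y / x * y}.
Proof. by move=> x y; rewrite -mulqE. Qed.

HB.instance Definition _ := isMultiplicative.Build G quotg qclass qclassM.

End Quotients.


Section Automorphisms.
Variable G : groupType.

Definition is_aut (f : G -> G) : bool :=
  `[< {morph f : x y / x * y} /\ bijective f >].

Record aut := Aut { aut_fun :> G -> G; autP : is_aut aut_fun }.

HB.instance Definition _ := [isSub for aut_fun].
HB.instance Definition _ := [Choice of aut by <:].

Lemma aut_ext (a b : aut) : a =1 b -> a = b.
Proof. by move=> ab; apply/val_inj/funext. Qed.

Lemma autM (a : aut) : {morph a : x y / x * y}.
Proof. by have /asboolP[] := autP a. Qed.

Lemma aut_bij (a : aut) : bijective a.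
Proof. by have /asboolP[] := autP a. Qed.

HB.instance Definition _ (a : aut) := isMultiplicative.Build G G a (autM a).

Fact aut_one_subproof : is_aut idfun.
Proof. by apply/asboolP; split=> //; exists idfun. Qed.

Fact aut_mul_subproof (a b : aut) : is_aut (a \o b).
Proof.
apply/asboolP; split=> [x y|]; first by rewrite /= !autM.
by apply: bij_comp; exact: aut_bij.
Qed.

Definition aut_inv_fun (a : aut) (y : G) : G :=
  let: exist x _ := cid (let: Bijective f _ fK := aut_bij a in
    ex_intro (fun x => a x = y) (f y) (fK y)) in x.

Fact aut_inv_funK (a : aut) : cancel (aut_inv_fun a) a.
Proof. by move=> y; rewrite /aut_inv_fun; case: cid. Qed.

Fact aut_funK (a : aut) : cancel a (aut_inv_fun a).
Proof. by move=> x; apply: (bij_inj (aut_bij a)); rewrite aut_inv_funK. Qed.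

Fact aut_inv_subproof (a : aut) : is_aut (aut_inv_fun a).
Proof.
apply/asboolP; split; last by exists a; [exact: aut_inv_funK|exact: aut_funK].
by apply: (@can2_gmulfM _ _ a); [exact: aut_funK|exact: aut_inv_funK].
Qed.

Definition aut_one := Aut aut_one_subproof.
Definition aut_mul a b := Aut (aut_mul_subproof a b).
Definition aut_inv a := Aut (aut_inv_subproof a).

Fact aut_mulA : associative aut_mul. Proof. by move=> a b c; exact/aut_ext. Qed.
Fact aut_mul1 : left_id aut_one aut_mul. Proof. by move=> a; exact/aut_ext. Qed.
Fact aut_1mul : right_id aut_one aut_mul. Proof. by move=> a; exact/aut_ext. Qed.
Fact aut_mulV : left_inverse aut_one aut_inv aut_mul.
Proof. by move=> a; apply/aut_ext => x; exact: aut_funK. Qed.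
Fact aut_Vmul : right_inverse aut_one aut_inv aut_mul.
Proof. by move=> a; apply/aut_ext => x; exact: aut_inv_funK. Qed.

HB.instance Definition _ :=
  isGroup.Build aut aut_mulA aut_mul1 aut_1mul aut_mulV aut_Vmul.

Lemma autV (a : aut) x : a x^-1 = (a x)^-1. Proof. exact: (homV a). Qed.
Lemma autE (a b : aut) x : (a * b) x = a (b x). Proof. by []. Qed.
Lemma aut1E x : (1 : aut) x = x. Proof. by []. Qed.
Lemma aut_invl (a : aut) : cancel a a^-1. Proof. exact: aut_funK. Qed.
Lemma aut_invr (a : aut) : cancel a^-1 a. Proof. exact: aut_inv_funK. Qed.

Fact inner_subproof (g : G) : is_aut (fun x => g * x * g^-1).
Proof.
apply/asboolP; split=> [x y|]; first by rewrite !mulgA mulgVK.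
exists (fun x => g^-1 * x * g) => x; first by rewrite !mulgA mulVg mul1g mulgVK.
by rewrite !mulgA mulgV mul1g mulgK.
Qed.

Definition inner (g : G) : aut := Aut (inner_subproof g).

Lemma innerE g x : inner g x = g * x * g^-1. Proof. by []. Qed.

Fact innerM : {morph inner : x y / x * y}.
Proof. by move=> x y; apply/aut_ext => z /=; rewrite invgM !mulgA. Qed.

HB.instance Definition _ := isMultiplicative.Build G aut inner innerM.

Lemma innerV g : inner g^-1 = (inner g)^-1.
Proof. exact: (homV inner). Qed.

Lemma inner_conj (a : aut) g : a * inner g * a^-1 = inner (a g).
Proof. by apply/aut_ext => x; rewrite !autE !innerE !autM autV aut_invr. Qed.

End Automorphisms.

Section ImageSubgroup.
Variables (G H : groupType) (f : {multiplicative G -> H}).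

Definition image_subg : {pred H} := fun y => `[< exists x, f x = y >].

Fact image_subgM : mulg_closed image_subg.
Proof.
move=> _ _ /asboolP[x <-] /asboolP[y <-].
by apply/asboolP; exists (x * y); rewrite gmulfM.
Qed.

Fact image_subg1 : 1 \in image_subg.
Proof. by apply/asboolP; exists 1; exact: hom1. Qed.

Fact image_subgV : invg_closed image_subg.
Proof. by move=> _ /asboolP[x <-]; apply/asboolP; exists x^-1; exact: homV. Qed.

HB.instance Definition _ := isMulClosed.Build H image_subg image_subgM.
HB.instance Definition _ := isMul1Closed.Build H image_subg image_subg1.
HB.instance Definition _ := isInvClosed.Build H image_subg image_subgV.

End ImageSubgroup.

Section OuterAutomorphisms.
Variable K : groupType.

Fact inner_normal (a b : aut K) :
  a \in image_subg (@inner K) -> b * a * b^-1 \in image_subg (@inner K).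
Proof.
by move=> /asboolP[g <-]; apply/asboolP; exists (b g); rewrite inner_conj.
Qed.

HB.instance Definition _ :=
  isConjClosed.Build (aut K) (image_subg (@inner K)) inner_normal.
End OuterAutomorphisms.

Definition Out (K : groupType) := quotg (image_subg (@inner K)).

Section ModKOuterAutomorphisms.
Variables (K M : groupType) (i : {multiplicative K -> M}).

Definition preserves_range : {pred aut M} :=
  fun a => `[< [set a x | x in range i]%classic = range i >].

Lemma preserves_rangeP (a : aut M) :
  a \in preserves_range <->
  (forall k, exists k', a (i k) = i k') /\ (forall k, exists k', i k = a (i k')).
Proof.
split=> [/asboolP e|[h1 h2]].
  split=> k.
    have [k' _ <-] : range i (a (i k)); last by exists k'.
    by rewrite -e; exists (i k) => //; exists k.
  have [_ [k' _ <-] <-] : [set a x | x in range i]%classic (i k).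
    by rewrite e; exists k.
  by exists k'.
apply/asboolP/seteqP; split=> [_ [_ [k _ <-] <-]|_ [k _ <-]].
  by have [k' ->] := h1 k; exists k'.
by have [k' ->] := h2 k; exists (i k') => //; exists k'.
Qed.

Fact preserves_rangeM : mulg_closed preserves_range.
Proof.
move=> a b /preserves_rangeP[a1 a2] /preserves_rangeP[b1 b2].
apply/preserves_rangeP; split=> k.
  by have [k' e] := b1 k; have [k'' e'] := a1 k'; exists k''; rewrite autE e.
by have [k' e] := a2 k; have [k'' e'] := b2 k'; exists k''; rewrite autE -e'.
Qed.

Fact preserves_range1 : 1 \in preserves_range.
Proof. by apply/preserves_rangeP; split=> k; exists k. Qed.

Fact preserves_rangeV : invg_closed preserves_range.
Proof.
move=> a /preserves_rangeP[a1 a2]; apply/preserves_rangeP; split=> k.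
  by have [k' ->] := a2 k; exists k'; rewrite aut_invl.
by have [k' e] := a1 k; exists k'; rewrite -e aut_invl.
Qed.

HB.instance Definition _ := isMulClosed.Build _ preserves_range preserves_rangeM.
HB.instance Definition _ := isMul1Closed.Build _ preserves_range preserves_range1.
HB.instance Definition _ := isInvClosed.Build _ preserves_range preserves_rangeV.

Definition AutK := subg preserves_range.

Definition innerK : {pred AutK} :=
  fun a => `[< exists k, val a = inner (i k) >].

Fact innerKM : mulg_closed innerK.
Proof.
move=> a b /asboolP[k ak] /asboolP[l bl].
by apply/asboolP; exists (k * l); rewrite valM ak bl !gmulfM.
Qed.

Fact innerK1 : 1 \in innerK.
Proof. by apply/asboolP; exists 1; rewrite hom1 (hom1 (@inner M)). Qed.

Fact innerKV : invg_closed innerK.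
Proof.
move=> a /asboolP[k ak]; apply/asboolP; exists k^-1.
by rewrite valV ak homV -innerV.
Qed.

Fact innerKJ (a b : AutK) : a \in innerK -> b * a * b^-1 \in innerK.
Proof.
move=> /asboolP[k ak]; apply/asboolP.
have [b1 _] := (preserves_rangeP (val b)).1 (valP b).
have [k' e] := b1 k; exists k'.
by rewrite !valM valV ak inner_conj e.
Qed.

HB.instance Definition _ := isMulClosed.Build _ innerK innerKM.
HB.instance Definition _ := isMul1Closed.Build _ innerK innerK1.
HB.instance Definition _ := isInvClosed.Build _ innerK innerKV.
HB.instance Definition _ := isConjClosed.Build _ innerK innerKJ.

Definition OutK := quotg innerK.

End ModKOuterAutomorphisms.

Section Center.
Variable K : groupType.

Definition center : {pred K} := fun z => `[< forall x, commute z x >].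

Fact centerM : mulg_closed center.
Proof.
move=> x y /asboolP cx /asboolP cy; apply/asboolP => z.
by rewrite /commute -mulgA [y * z]cy mulgA [x * z]cx mulgA.
Qed.

Fact center1 : 1 \in center.
Proof. by apply/asboolP => x; rewrite /commute mul1g mulg1. Qed.

Fact centerV : invg_closed center.
Proof.
move=> x /asboolP cx; apply/asboolP => y.
by apply: (mulgI x); rewrite /commute mulVKg mulgA [x * y]cx mulgK.
Qed.

HB.instance Definition _ := isMulClosed.Build _ center centerM.
HB.instance Definition _ := isMul1Closed.Build _ center center1.
HB.instance Definition _ := isInvClosed.Build _ center centerV.

Definition Z := subg center.

Lemma ZC (x y : Z) : commute x y.
Proof. by apply/val_inj; rewrite !gmulfM; have /asboolP -> := valP x. Qed.

Fact autZ_in (a : aut K) (z : Z) : a (val z) \in center.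
Proof.
have /asboolP cz := valP z; apply/asboolP => x.
by rewrite -(aut_invr a x) /commute -!autM cz.
Qed.

Definition autZ_fun (a : aut K) (z : Z) : Z := Subg (autZ_in a z).

Fact autZ_subproof (a : aut K) : is_aut (autZ_fun a).
Proof.
apply/asboolP; split=> [x y|]; first by apply/val_inj => /=; rewrite !gmulfM.
by exists (autZ_fun a^-1) => z; apply/val_inj; [exact: aut_invl|exact: aut_invr].
Qed.

Definition autZ (a : aut K) : aut Z := Aut (autZ_subproof a).

Fact autZM : {morph autZ : x y / x * y}.
Proof. by move=> a b; apply/aut_ext => z; exact/val_inj. Qed.

HB.instance Definition _ := isMultiplicative.Build _ _ autZ autZM.

(* Inner automorphisms act trivially on Z(K), hence Out(K) acts on Z(K).       *)
Definition outZ (c : Out K) : aut Z := autZ (repr c).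

Lemma outZE (a : aut K) : outZ (qclass _ a) = autZ a.
Proof.
have /asboolP[g e] := reprq (image_subg (@inner K)) a.
rewrite /outZ -[repr _](mulVKg a) -e gmulfM -[RHS]mulg1; congr (_ * _).
apply/aut_ext => z; apply/val_inj => /=.
by have /asboolP cz := valP z; rewrite -(cz g) mulgK.
Qed.

Fact outZM : {morph outZ : x y / x * y}.
Proof.
move=> c d; have [a ->] := qclass_surj c; have [b ->] := qclass_surj d.
by rewrite -gmulfM !outZE gmulfM.
Qed.

HB.instance Definition _ := isMultiplicative.Build _ _ outZ outZM.

End Center.

(* An H-module: an abelian group, written multiplicatively, with an H-action.  *)
Record hmodule (H : groupType) := HModule {
  hmod_group :> groupType;
  hmodC : forall x y : hmod_group, commute x y;
  hmod_act : {multiplicative H -> aut hmod_group}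
}.

Lemma hmodACA (H : groupType) (A : hmodule H) (x y z t : A) :
  x * y * (z * t) = x * z * (y * t).
Proof. by rewrite -!mulgA; congr (_ * _); rewrite !mulgA (hmodC y). Qed.

Definition restr_module (H' H : groupType) (f : {multiplicative H' -> H})
  (A : hmodule H) : hmodule H' :=
  HModule (@hmodC _ A) (hmod_act A \o f).

Definition center_module (K Q : groupType) (theta : {multiplicative Q -> Out K}) :
  hmodule Q := HModule (@ZC K) (@outZ K \o theta).

Section FirstCohomology.
Variables (H : groupType) (A : hmodule H).

Definition is_cocycle (l : H -> A) : bool :=
  `[< forall h1 h2, l (h1 * h2) = l h1 * hmod_act A h1 (l h2) >].

Record Z1 := Cocycle { cocycle_fun :> H -> A; cocycleP : is_cocycle cocycle_fun }.

HB.instance Definition _ := [isSub for cocycle_fun].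
HB.instance Definition _ := [Choice of Z1 by <:].

Lemma Z1_ext (l m : Z1) : l =1 m -> l = m.
Proof. by move=> lm; apply/val_inj/funext. Qed.

Lemma cocycleE (l : Z1) h1 h2 :
  l (h1 * h2) = l h1 * hmod_act A h1 (l h2).
Proof. by have /asboolP := cocycleP l. Qed.

Lemma cocycle1 (l : Z1) : l 1 = 1.
Proof.
by apply: (mulgI (l 1)); rewrite mulg1 -[in RHS](mulg1 1) cocycleE hom1.
Qed.

Fact Z1_one_subproof : is_cocycle (fun=> 1).
Proof. by apply/asboolP => h1 h2; rewrite mul1g (hom1 (hmod_act A h1)). Qed.

Fact Z1_mul_subproof (l m : Z1) : is_cocycle (fun h => l h * m h).
Proof.
by apply/asboolP => h1 h2; rewrite !cocycleE autM hmodACA.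
Qed.

Fact Z1_inv_subproof (l : Z1) : is_cocycle (fun h => (l h)^-1).
Proof. by apply/asboolP => h1 h2; rewrite cocycleE autV invgM hmodC. Qed.

Definition Z1_one := Cocycle Z1_one_subproof.
Definition Z1_mul l m := Cocycle (Z1_mul_subproof l m).
Definition Z1_inv l := Cocycle (Z1_inv_subproof l).

Fact Z1_mulA : associative Z1_mul.
Proof. by move=> l m n; apply/Z1_ext => h /=; rewrite mulgA. Qed.
Fact Z1_mul1 : left_id Z1_one Z1_mul.
Proof. by move=> l; apply/Z1_ext => h /=; rewrite mul1g. Qed.
Fact Z1_1mul : right_id Z1_one Z1_mul.
Proof. by move=> l; apply/Z1_ext => h /=; rewrite mulg1. Qed.
Fact Z1_mulV : left_inverse Z1_one Z1_inv Z1_mul.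
Proof. by move=> l; apply/Z1_ext => h /=; rewrite mulVg. Qed.
Fact Z1_Vmul : right_inverse Z1_one Z1_inv Z1_mul.
Proof. by move=> l; apply/Z1_ext => h /=; rewrite mulgV. Qed.

HB.instance Definition _ :=
  isGroup.Build Z1 Z1_mulA Z1_mul1 Z1_1mul Z1_mulV Z1_Vmul.

Lemma Z1M (l m : Z1) h : (l * m) h = l h * m h. Proof. by []. Qed.
Lemma Z1V (l : Z1) h : l^-1 h = (l h)^-1. Proof. by []. Qed.

Lemma Z1C (l m : Z1) : commute l m.
Proof. by apply/Z1_ext => h; rewrite !Z1M hmodC. Qed.

Definition B1 : {pred Z1} :=
  fun l => `[< exists a : A, forall h, l h = a^-1 * hmod_act A h a >].

Fact B1M : mulg_closed B1.
Proof.
move=> l m /asboolP[a la] /asboolP[b mb]; apply/asboolP; exists (a * b) => h.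
by rewrite Z1M la mb autM invgM (hmodC b^-1 a^-1) hmodACA.
Qed.

Fact B1_1 : 1 \in B1.
Proof.
by apply/asboolP; exists 1 => h; rewrite (hom1 (hmod_act A h)) mulVg.
Qed.

Fact B1V : invg_closed B1.
Proof.
move=> l /asboolP[a la]; apply/asboolP; exists a^-1 => h.
by rewrite Z1V la autV invgM hmodC.
Qed.

Fact B1J (l m : Z1) : l \in B1 -> m * l * m^-1 \in B1.
Proof. by rewrite Z1C mulKg. Qed.

HB.instance Definition _ := isMulClosed.Build _ B1 B1M.
HB.instance Definition _ := isMul1Closed.Build _ B1 B1_1.
HB.instance Definition _ := isInvClosed.Build _ B1 B1V.
HB.instance Definition _ := isConjClosed.Build _ B1 B1J.

Definition H1 := quotg B1.

End FirstCohomology.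
Arguments B1 {H} A _.

Section RestrictedCocycles.
Variables (H' H : groupType) (f : {multiplicative H' -> H}) (A : hmodule H).

Fact res_cocycle_subproof (l : Z1 A) :
  @is_cocycle _ (restr_module f A) (l \o f).
Proof. by apply/asboolP => h1 h2; rewrite /= gmulfM cocycleE. Qed.

Definition res_cocycle (l : Z1 A) : Z1 (restr_module f A) :=
  Cocycle (res_cocycle_subproof l).

End RestrictedCocycles.

Record extension (K Q : groupType) := Extension {
  ext_group :> groupType;
  ext_i : {multiplicative K -> ext_group};
  ext_pi : {multiplicative ext_group -> Q};
  ext_i_inj : injective ext_i;
  ext_pi_surj : forall q, exists g, ext_pi g = q;
  ext_exact : forall g, (exists k, ext_i k = g) <-> ext_pi g = 1
}.
Arguments ext_i {K Q} e.
Arguments ext_pi {K Q} e.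

Section ExtensionTheory.
Variables (K Q : groupType) (G : extension K Q).

Lemma ext_pi_i k : ext_pi G (ext_i G k) = 1.
Proof. by apply/ext_exact; exists k. Qed.

(* An arbitrary set-theoretic section of [ext_pi G].                           *)
Definition ext_lift (q : Q) : G := let: exist g _ := cid (ext_pi_surj G q) in g.

Lemma ext_liftK : cancel ext_lift (ext_pi G).
Proof. by move=> q; rewrite /ext_lift; case: cid. Qed.

Fact ext_conj_ex (g : G) (k : K) :
  exists k', ext_i G k' = g * ext_i G k * g^-1.
Proof. by apply/ext_exact; rewrite !gmulfM homV ext_pi_i mulg1 mulgV. Qed.

Definition ext_conj_fun (g : G) (k : K) : K :=
  let: exist k' _ := cid (ext_conj_ex g k) in k'.

Lemma ext_conj_funE g k : ext_i G (ext_conj_fun g k) = g * ext_i G k * g^-1.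
Proof. by rewrite /ext_conj_fun; case: cid. Qed.

Fact ext_conj_funM g h k :
  ext_conj_fun (g * h) k = ext_conj_fun g (ext_conj_fun h k).
Proof.
by apply: (ext_i_inj (e := G)); rewrite !ext_conj_funE invgM !mulgA.
Qed.

Fact ext_conj_fun1 k : ext_conj_fun 1 k = k.
Proof.
by apply: (ext_i_inj (e := G)); rewrite ext_conj_funE mul1g invg1 mulg1.
Qed.

Fact ext_conj_subproof g : is_aut (ext_conj_fun g).
Proof.
apply/asboolP; split=> [x y|].
  apply: (ext_i_inj (e := G)).
  by rewrite ext_conj_funE !gmulfM !ext_conj_funE !mulgA mulgVK.
by exists (ext_conj_fun g^-1) => k;
  rewrite -ext_conj_funM ?mulVg ?mulgV ext_conj_fun1.
Qed.

Definition ext_conj (g : G) : aut K := Aut (ext_conj_subproof g).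

Lemma ext_conjE g k : ext_i G (ext_conj g k) = g * ext_i G k * g^-1.
Proof. exact: ext_conj_funE. Qed.

Fact ext_conjM : {morph ext_conj : g h / g * h}.
Proof. by move=> g h; apply/aut_ext => k; exact: ext_conj_funM. Qed.

HB.instance Definition _ := isMultiplicative.Build _ _ ext_conj ext_conjM.

Definition has_outer_action (theta : {multiplicative Q -> Out K}) : Prop :=
  forall g : G, theta (ext_pi G g) = qclass _ (ext_conj g).

Definition ext_aut_pred : {pred aut G} := fun xi =>
  `[< xi \o ext_i G = ext_i G /\ ext_pi G \o xi = ext_pi G >].

Lemma ext_aut_predP (xi : aut G) : xi \in ext_aut_pred <->
  (forall k, xi (ext_i G k) = ext_i G k) /\
  (forall g, ext_pi G (xi g) = ext_pi G g).
Proof.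
split=> [/asboolP[e1 e2]|[e1 e2]].
  by split=> [k|g]; [exact: (congr1 (@^~ k) e1)|exact: (congr1 (@^~ g) e2)].
by apply/asboolP; split; apply/funext.
Qed.

Fact ext_autM : mulg_closed ext_aut_pred.
Proof.
move=> a b /ext_aut_predP[a1 a2] /ext_aut_predP[b1 b2].
by apply/ext_aut_predP; split=> x; rewrite autE ?b1 ?a1 ?a2 ?b2.
Qed.

Fact ext_aut1 : 1 \in ext_aut_pred.
Proof. exact/ext_aut_predP. Qed.

Fact ext_autV : invg_closed ext_aut_pred.
Proof.
move=> a /ext_aut_predP[a1 a2]; apply/ext_aut_predP; split=> x.
  by rewrite -[in LHS]a1 aut_invl.
by rewrite -a2 aut_invr.
Qed.

HB.instance Definition _ := isMulClosed.Build _ ext_aut_pred ext_autM.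
HB.instance Definition _ := isMul1Closed.Build _ ext_aut_pred ext_aut1.
HB.instance Definition _ := isInvClosed.Build _ ext_aut_pred ext_autV.

Definition AutE := subg ext_aut_pred.

Fact AutE_AutK_subproof (xi : AutE) : val xi \in preserves_range (ext_i G).
Proof.
have [e _] := (ext_aut_predP (val xi)).1 (valP xi).
by apply/preserves_rangeP; split=> k; exists k; rewrite e.
Qed.

Definition AutE_AutK (xi : AutE) : AutK (ext_i G) :=
  Subg (AutE_AutK_subproof xi).

Fact AutE_AutKM : {morph AutE_AutK : x y / x * y}.
Proof. by move=> x y; exact/val_inj. Qed.

HB.instance Definition _ := isMultiplicative.Build _ _ AutE_AutK AutE_AutKM.

Definition AutE_class : AutE -> OutK (ext_i G) := @qclass _ _ \o AutE_AutK.

HB.instance Definition _ := Multiplicative.on AutE_class.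

Definition OutE := subg (image_subg AutE_class).

End ExtensionTheory.
Arguments ext_aut_pred {K Q} G _.

Section SubExtension.
Variables (K P R : groupType) (B : extension P R) (G : extension K B).

Definition subext_pred : {pred G} :=
  fun g => `[< exists p, ext_pi G g = ext_i B p >].

Fact subext_predM : mulg_closed subext_pred.
Proof.
move=> g h /asboolP[p gp] /asboolP[q hq]; apply/asboolP; exists (p * q).
by rewrite !gmulfM gp hq.
Qed.

Fact subext_pred1 : 1 \in subext_pred.
Proof. by apply/asboolP; exists 1; rewrite !hom1. Qed.

Fact subext_predV : invg_closed subext_pred.
Proof.
by move=> g /asboolP[p gp]; apply/asboolP; exists p^-1; rewrite !homV gp.
Qed.

HB.instance Definition _ := isMulClosed.Build _ subext_pred subext_predM.
HB.instance Definition _ := isMul1Closed.Build _ subext_pred subext_pred1.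
HB.instance Definition _ := isInvClosed.Build _ subext_pred subext_predV.

(* N; the inclusion j : N -> G is [val].                                       *)
Definition subext_group := subg subext_pred.

Fact subext_i_in k : ext_i G k \in subext_pred.
Proof. by apply/asboolP; exists 1; rewrite ext_pi_i hom1. Qed.

Definition subext_i (k : K) : subext_group := Subg (subext_i_in k).

Fact subext_iM : {morph subext_i : x y / x * y}.
Proof. by move=> x y; apply/val_inj => /=; rewrite gmulfM. Qed.

HB.instance Definition _ := isMultiplicative.Build _ _ subext_i subext_iM.

Definition subext_pi (n : subext_group) : P :=
  let: exist p _ := cid (asboolW (valP n)) in p.

Lemma subext_piE n : ext_i B (subext_pi n) = ext_pi G (val n).
Proof. by rewrite /subext_pi; case: cid. Qed.

Fact subext_piM : {morph subext_pi : x y / x * y}.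
Proof.
by move=> x y; apply: (ext_i_inj (e := B)); rewrite gmulfM !subext_piE gmulfM.
Qed.

HB.instance Definition _ := isMultiplicative.Build _ _ subext_pi subext_piM.

Fact subext_i_inj : injective subext_i.
Proof. by move=> x y /(congr1 val); exact: ext_i_inj. Qed.

Fact subext_pi_surj p : exists n, subext_pi n = p.
Proof.
have [g gp] := ext_pi_surj G (ext_i B p).
have gN : g \in subext_pred by apply/asboolP; exists p.
by exists (Subg gN); apply: (ext_i_inj (e := B)); rewrite subext_piE.
Qed.

Fact subext_exact n : (exists k, subext_i k = n) <-> subext_pi n = 1.
Proof.
have e : subext_pi n = 1 <-> ext_pi G (val n) = 1.
  rewrite -subext_piE; split=> [->|h]; first exact: hom1.
  by apply: (ext_i_inj (e := B)); rewrite h hom1.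
apply: (iff_trans _ (iff_sym e)); apply: (iff_trans _ (ext_exact _)).
by split=> -[k kn]; exists k; [rewrite -kn|exact: val_inj].
Qed.

Definition subextension : extension K P :=
  @Extension K P subext_group subext_i subext_pi
    subext_i_inj subext_pi_surj subext_exact.

End SubExtension.
Arguments subext_pred {K P R B} G _.

(* [(G, j, ext_pi G)] is an iterated extension of [N] by [B].                  *)
Definition is_iterated_extension (K P R : groupType) (N : extension K P)
    (B : extension P R) (G : groupType) (j : {multiplicative N -> G})
    (pi : {multiplicative G -> B}) : Prop :=
  [/\ injective j, forall q, exists g, pi g = q,
      forall n, pi (j n) = ext_i B (ext_pi N n),
      forall g, (exists n, j n = g) <-> ext_pi B (pi g) = 1 &
      forall g, (exists k, j (ext_i N k) = g) <-> pi g = 1].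

Section IteratedExtension.
Variables (K P R : groupType) (B : extension P R) (G : extension K B).
Let N := subextension G.

Definition subext_j (n : N) : G := val n.

Fact subext_jM : {morph subext_j : x y / x * y}.
Proof. by []. Qed.

HB.instance Definition _ := isMultiplicative.Build _ _ subext_j subext_jM.

Lemma subext_iterated :
  is_iterated_extension (N := N) (subext_j : {multiplicative N -> G}) (ext_pi G).
Proof.
split.
- exact: val_inj.
- exact: ext_pi_surj.
- by move=> n; rewrite /= subext_piE.
- move=> g; split=> [[n <-]|/ext_exact[p pg]].
    by rewrite -subext_piE ext_pi_i.
  have gN : g \in subext_pred G by apply/asboolP; exists p.
  by exists (Subg gN).
- exact: ext_exact.
Qed.

Fact subext_conj_in (g : G) (n : N) : g * val n * g^-1 \in subext_pred G.
Proof.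
have /asboolP[p np] := valP n; apply/asboolP; exists (ext_conj (ext_pi G g) p).
by rewrite ext_conjE !gmulfM homV np.
Qed.

Definition subext_conj_fun (g : G) (n : N) : N := Subg (subext_conj_in g n).

Fact subext_conj_funM g h n :
  subext_conj_fun (g * h) n = subext_conj_fun g (subext_conj_fun h n).
Proof. by apply/val_inj => /=; rewrite invgM !mulgA. Qed.

Fact subext_conj_fun1 n : subext_conj_fun 1 n = n.
Proof. by apply/val_inj => /=; rewrite mul1g invg1 mulg1. Qed.

Fact subext_conj_subproof g : is_aut (subext_conj_fun g).
Proof.
apply/asboolP; split=> [x y|].
  by apply/val_inj => /=; rewrite !mulgA mulgVK.
by exists (subext_conj_fun g^-1) => n;
  rewrite -subext_conj_funM ?mulVg ?mulgV subext_conj_fun1.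
Qed.

Fact subext_conj_AutK g : Aut (subext_conj_subproof g) \in preserves_range (ext_i N).
Proof.
apply/preserves_rangeP; split=> k.
  by exists (ext_conj g k); apply/val_inj; rewrite /= ext_conjE.
exists (ext_conj g^-1 k); apply/val_inj => /=.
by rewrite ext_conjE invgK !mulgA mulgV mul1g mulgK.
Qed.

Definition subext_conj (g : G) : AutK (ext_i N) := Subg (subext_conj_AutK g).

Lemma subext_conjE g (n : N) : val (val (subext_conj g) n) = g * val n * g^-1.
Proof. by []. Qed.

Fact subext_conjM : {morph subext_conj : g h / g * h}.
Proof. by move=> g h; apply/val_inj/aut_ext => n; exact: subext_conj_funM. Qed.

HB.instance Definition _ := isMultiplicative.Build _ _ subext_conj subext_conjM.

Definition modK_outer_action (q : B) : OutK (ext_i N) :=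
  qclass _ (subext_conj (ext_lift G q)).

Lemma modK_outer_actionE (g : G) :
  modK_outer_action (ext_pi G g) = qclass _ (subext_conj g).
Proof.
apply/qclassP; apply/asboolP; set h := ext_lift _ _.
have [k kE] : exists k, ext_i G k = h^-1 * g.
  by apply/ext_exact; rewrite gmulfM homV ext_liftK mulVg.
exists k; rewrite -(homV subext_conj) -gmulfM; apply/aut_ext => n.
by apply/val_inj; rewrite /= kE.
Qed.

Fact modK_outer_actionM : {morph modK_outer_action : q r / q * r}.
Proof.
move=> q r; have [g <-] := ext_pi_surj G q; have [h <-] := ext_pi_surj G r.
by rewrite -gmulfM !modK_outer_actionE !gmulfM.
Qed.

HB.instance Definition _ :=
  isMultiplicative.Build _ _ modK_outer_action modK_outer_actionM.

Fact AutE_restr_in (xi : AutE G) (n : N) : val xi (val n) \in subext_pred G.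
Proof.
have [_ e] := (ext_aut_predP (val xi)).1 (valP xi).
by have /asboolP[p np] := valP n; apply/asboolP; exists p; rewrite e.
Qed.

Definition AutE_restr_fun (xi : AutE G) (n : N) : N := Subg (AutE_restr_in xi n).

Fact AutE_restr_subproof xi : is_aut (AutE_restr_fun xi).
Proof.
apply/asboolP; split=> [x y|].
  by apply/val_inj => /=; rewrite autM.
exists (AutE_restr_fun xi^-1) => n; apply/val_inj.
  exact: (aut_invl (val xi) (val n)).
exact: (aut_invr (val xi) (val n)).
Qed.

Fact AutE_restr_AutE xi : Aut (AutE_restr_subproof xi) \in ext_aut_pred N.
Proof.
have [e1 e2] := (ext_aut_predP (val xi)).1 (valP xi).
apply/ext_aut_predP; split=> [k|n]; first by apply/val_inj; exact: e1.
by apply: (ext_i_inj (e := B)); rewrite /= !subext_piE /= e2.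
Qed.

Definition AutE_restr (xi : AutE G) : AutE N := Subg (AutE_restr_AutE xi).

Lemma AutE_restrE xi (n : N) :
  subext_j (val (AutE_restr xi) n) = val xi (subext_j n).
Proof. by []. Qed.

Fact AutE_restrM : {morph AutE_restr : x y / x * y}.
Proof. by move=> x y; apply/val_inj/aut_ext => n; exact/val_inj. Qed.

HB.instance Definition _ := isMultiplicative.Build _ _ AutE_restr AutE_restrM.

End IteratedExtension.

Section CompatibleAutomorphisms.
Variables (K P Q : groupType) (N : extension K P).
Variable Theta : Q -> OutK (ext_i N).

Definition compatible (eta : AutK (ext_i N)) : Prop :=
  forall q, commute (qclass _ eta) (Theta q).

Definition compatibleE : {pred AutE N} := fun eta => `[< compatible (AutE_AutK eta) >].

Fact compatibleEM : mulg_closed compatibleE.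
Proof.
move=> a b /asboolP ca /asboolP cb; apply/asboolP => q.
by rewrite !gmulfM; apply/commute_sym/commuteM; apply/commute_sym;
  [exact: ca | exact: cb].
Qed.

Fact compatibleE1 : 1 \in compatibleE.
Proof.
apply/asboolP => q; rewrite (hom1 (@AutE_AutK _ _ N)) (hom1 (@qclass _ _)).
exact/commute_sym/commute1.
Qed.

Fact compatibleEV : invg_closed compatibleE.
Proof.
move=> a /asboolP ca; apply/asboolP => q.
rewrite (homV (@AutE_AutK _ _ N)) (homV (@qclass _ _)).
exact/commute_sym/commuteV/commute_sym/ca.
Qed.

HB.instance Definition _ := isMulClosed.Build _ compatibleE compatibleEM.
HB.instance Definition _ := isMul1Closed.Build _ compatibleE compatibleE1.
HB.instance Definition _ := isInvClosed.Build _ compatibleE compatibleEV.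

Definition AutTheta := subg compatibleE.

Definition AutTheta_class : AutTheta -> OutK (ext_i N) := @AutE_class _ _ N \o val.

HB.instance Definition _ := Multiplicative.on AutTheta_class.

Definition OutTheta := subg (image_subg AutTheta_class).

End CompatibleAutomorphisms.
Arguments compatibleE {K P Q N} Theta _.

(* The action of R on H^1(P,A), for a Q-module A and an extension B of P by R  *)
(* with total group Q.                                                         *)
Section ActionOnCohomology.
Variables (P R : groupType) (B : extension P R) (A : hmodule B).
Let AP := restr_module (ext_i B) A.

Fact conj_cocycle_subproof (q : B) (l : Z1 AP) :
  @is_cocycle _ AP (fun p => hmod_act A q (l (ext_conj q^-1 p))).
Proof.
apply/asboolP => p1 p2.
have e : ext_i B (ext_conj q^-1 p1) = q^-1 * ext_i B p1 * q.
  by rewrite ext_conjE invgK.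
rewrite autM cocycleE autM; congr (_ * _) => /=.
by rewrite -!autE -!gmulfM e !mulgA mulgV mul1g.
Qed.

Definition conj_cocycle (q : B) (l : Z1 AP) : Z1 AP :=
  Cocycle (conj_cocycle_subproof q l).

Lemma conj_cocycleE q l p :
  conj_cocycle q l p = hmod_act A q (l (ext_conj q^-1 p)).
Proof. by []. Qed.

Fact conj_cocycleM q : {morph conj_cocycle q : l m / l * m}.
Proof. by move=> l m; apply/Z1_ext => p; rewrite /= autM. Qed.

Fact conj_cocycle_comp q r l :
  conj_cocycle (q * r) l = conj_cocycle q (conj_cocycle r l).
Proof.
apply/Z1_ext => p; rewrite !conj_cocycleE -autE -gmulfM; congr (_ _ _).
by rewrite invgM gmulfM autE.
Qed.

Fact conj_cocycle_B1 q l : l \in B1 AP -> conj_cocycle q l \in B1 AP.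
Proof.
move=> /asboolP[a la]; apply/asboolP; exists (hmod_act A q a) => p.
rewrite conj_cocycleE la autM autV /=; congr (_ * _).
by rewrite -!autE -!gmulfM ext_conjE invgK !mulgA mulgV mul1g.
Qed.

(* P acts trivially on H^1(P,A), so the class of [conj_cocycle q l] only       *)
(* depends on the image of [q] in R.                                           *)
Fact conj_cocycle_triv x l :
  l^-1 * conj_cocycle (ext_i B x) l \in B1 AP.
Proof.
apply/asboolP; exists (l x) => p; rewrite Z1M Z1V conj_cocycleE.
have -> : ext_conj (ext_i B x)^-1 p = x^-1 * p * x.
  by apply: (ext_i_inj (e := B)); rewrite ext_conjE invgK !gmulfM homV.
have lV : hmod_act AP x (l x^-1) = (l x)^-1.
  by apply: (mulgI (l x)); rewrite -cocycleE !mulgV cocycle1.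
rewrite -mulgA cocycleE autM.
rewrite -[hmod_act A (ext_i B x) (l x^-1)]/(hmod_act AP x (l x^-1)) lV.
rewrite /= -autE -gmulfM -gmulfM mulgV (hom1 (ext_i B)) (hom1 (hmod_act A)) aut1E.
by rewrite cocycleE mulgA (hmodC (l p)^-1) -mulgA mulKg.
Qed.

Definition H1_act_fun (r : R) (c : H1 AP) : H1 AP :=
  qclass _ (conj_cocycle (ext_lift B r) (repr c)).

Lemma H1_act_funE (q : B) (l : Z1 AP) :
  H1_act_fun (ext_pi B q) (qclass _ l) = qclass _ (conj_cocycle q l).
Proof.
rewrite /H1_act_fun; set q' := ext_lift _ _.
have [x xE] : exists x, ext_i B x = q'^-1 * q.
  by apply/ext_exact; rewrite gmulfM homV ext_liftK mulVg.
have -> : conj_cocycle q l = conj_cocycle q' (conj_cocycle (ext_i B x) l).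
  by rewrite -conj_cocycle_comp xE mulVKg.
apply/qclassP; set m := repr _; set m' := conj_cocycle _ l.
have -> : (conj_cocycle q' m)^-1 * conj_cocycle q' m'
    = conj_cocycle q' (m^-1 * m').
  by apply: (mulgI (conj_cocycle q' m)); rewrite mulVKg -conj_cocycleM mulVKg.
apply: conj_cocycle_B1.
have -> : m^-1 * m' = (l^-1 * m)^-1 * (l^-1 * m').
  by rewrite invgM invgK mulgA mulgK.
apply: (gpredM (s := B1 AP)); last exact: conj_cocycle_triv.
by rewrite gpredV; exact: reprq.
Qed.

Fact H1_act_funM r s c : H1_act_fun (r * s) c = H1_act_fun r (H1_act_fun s c).
Proof.
have [q <-] := ext_pi_surj B r; have [t <-] := ext_pi_surj B s.
have [l ->] := qclass_surj c.
by rewrite -gmulfM !H1_act_funE conj_cocycle_comp.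
Qed.

Fact H1_act_fun1 c : H1_act_fun 1 c = c.
Proof.
have [l ->] := qclass_surj c; rewrite -(hom1 (ext_pi B)) H1_act_funE.
congr (qclass _ _); apply/Z1_ext => p.
by rewrite conj_cocycleE (hom1 (hmod_act A)) invg1 (hom1 (@ext_conj _ _ B)).
Qed.

Fact H1_act_subproof r : is_aut (H1_act_fun r).
Proof.
apply/asboolP; split=> [c d|].
  have [l ->] := qclass_surj c; have [m ->] := qclass_surj d.
  have [q <-] := ext_pi_surj B r.
  by rewrite -gmulfM !H1_act_funE conj_cocycleM gmulfM.
by exists (H1_act_fun r^-1) => c;
  rewrite -H1_act_funM ?mulVg ?mulgV H1_act_fun1.
Qed.

Definition H1_act (r : R) : aut (H1 AP) := Aut (H1_act_subproof r).

Lemma H1_actE (q : B) (l : Z1 AP) :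
  H1_act (ext_pi B q) (qclass _ l) = qclass _ (conj_cocycle q l).
Proof. exact: H1_act_funE. Qed.

Fact H1_actM : {morph H1_act : r s / r * s}.
Proof. by move=> r s; apply/aut_ext => c; exact: H1_act_funM. Qed.

HB.instance Definition _ := isMultiplicative.Build _ _ H1_act H1_actM.

Fact H1C (c d : H1 AP) : commute c d.
Proof.
have [l ->] := qclass_surj c; have [m ->] := qclass_surj d.
by rewrite /commute -!gmulfM Z1C.
Qed.

Definition H1_module : hmodule R := HModule H1C H1_act.

End ActionOnCohomology.

Section Invariants.
Variables (H : groupType) (A : hmodule H).

Definition invariant : {pred A} := fun a => `[< forall h, hmod_act A h a = a >].

Fact invariantM : mulg_closed invariant.
Proof.
by move=> a b /asboolP ia /asboolP ib; apply/asboolP => h; rewrite autM ia ib.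
Qed.

Fact invariant1 : 1 \in invariant.
Proof. by apply/asboolP => h; exact: (hom1 (hmod_act A h)). Qed.

Fact invariantV : invg_closed invariant.
Proof. by move=> a /asboolP ia; apply/asboolP => h; rewrite autV ia. Qed.

HB.instance Definition _ := isMulClosed.Build _ invariant invariantM.
HB.instance Definition _ := isMul1Closed.Build _ invariant invariant1.
HB.instance Definition _ := isInvClosed.Build _ invariant invariantV.

Definition invariants := subg invariant.

End Invariants.

(* Main.v *)
From HB Require Import structures.
Require Import Defs.
From mathcomp Require Import all_boot.
From mathcomp Require Import boolp.

(** An automorphism [xi] of an extension G of K by Q that induces the identity
    on K and on Q moves each [g] by an element [xi g * g^-1] of K.  Since [xi]
    fixes both [x] and [g^-1 * x * g] for [x] in K, this element is central in
    K; it depends only on the image of [g] in Q, and multiplicativity of [xi]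
    is the cocycle identity.  So [star], which sends a cocycle [l] to
    [g |-> l (pi g) * g], is an isomorphism from Z^1(Q,Z(K)) onto Aut(KGQ).
    Conjugation by a central [a] corresponds to the coboundary of [a^-1], and
    an inner automorphism by [k] in K belongs to Aut(KGQ) only if [k] is
    central; hence [star] identifies H^1 with the image of Aut(KGQ) in
    Out(G;K).  Those facts are [star_surj] and [star_on_H1], and they apply to
    G over Q as well as to N over P.

    For the subextension, let [xi] be in Aut(KGQ) and [c_g] conjugation by [g].
    Then [xi c_g xi^-1] is [c_(xi g)], and [xi g] differs from [g] by an element
    of K, so [xi] and [c_g] commute modulo inner automorphisms by K: this is
    [AutE_restr_compatible].  On the other hand [c_g] conjugates [star l] into
    [star] of the conjugate cocycle ([conj_star]), so by injectivity of [star]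
    on classes, [star l] is compatible with the outer action exactly when the
    class of [l] is R-invariant ([compatible_invariant]).  This turns the
    isomorphism for N into one between the invariants and Out_Theta(KNP;K), and
    it also shows that restricted classes are invariant, because
    [star (res l)] is the restriction of [star l] ([restr_star]).  The last
    equation is also the commutativity of the square. *)

Local Open Scope group_scope.

(** * Building homomorphisms *)

Lemma bijective_inj_surj (S T : Type) (f : S -> T) :
  injective f -> (forall y, exists x, f x = y) -> bijective f.
Proof.
move=> f_inj f_surj; have [g gK] := choice f_surj.
by exists g => // x; apply: f_inj; rewrite gK.
Qed.

Lemma ker_trivial_inj {X Y : groupType} (f : {multiplicative X -> Y}) :
  (forall x, f x = 1 -> x = 1) -> injective f.
Proof.
move=> f_ker x y fxy; apply: (mulgI x^-1); rewrite mulVg; apply/esym/f_ker.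
by rewrite gmulfM homV fxy mulVg.
Qed.

Lemma corestriction {A X : groupType} (T : groupClosed X)
    (f : {multiplicative A -> X}) :
  (forall a, f a \in T) ->
  exists h : {multiplicative A -> subg T}, forall a, subg_val (h a) = f a.
Proof.
move=> fT; pose h a := Subg (fT a).
have hM : {morph h : a b / a * b} by move=> a b; apply/val_inj/gmulfM.
pose hmult := isMultiplicative.Build A (subg T) h hM.
by exists (HB.pack_for {multiplicative A -> subg T} h hmult).
Qed.

(** Every map of the square that starts at a quotient, or at an image subgroup,
    comes from this lemma, with [f] the projection onto it. *)
Lemma factor_through {A X Y : groupType}
    (f : {multiplicative A -> X}) (g : {multiplicative A -> Y}) :
  (forall x, exists a, f a = x) -> (forall a, f a = 1 -> g a = 1) ->
  exists h : {multiplicative X -> Y}, forall a, h (f a) = g a.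
Proof.
move=> f_surj ker_fg; have [s sK] := choice f_surj.
have gs a : g (s (f a)) = g a.
  apply: (mulIg (g a)^-1); rewrite mulgV -homV -gmulfM; apply: ker_fg.
  by rewrite gmulfM homV sK mulgV.
pose h x := g (s x).
have hM : {morph h : x y / x * y}.
  by move=> x y; rewrite /h -{1}(sK x) -{1}(sK y) -gmulfM gs gmulfM.
pose hmult := isMultiplicative.Build X Y h hM.
by exists (HB.pack_for {multiplicative X -> Y} h hmult).
Qed.

Lemma qclass1P {X : groupType} (S : normalClosed X) (x : X) :
  qclass S x = 1 <-> x \in S.
Proof. by rewrite -(hom1 (qclass S)) -(gpredV S) -[x^-1]mulg1 -qclassP. Qed.

(** * Automorphisms of an extension and central cocycles *)

(** The Q-action on Z(K) is a parameter, known only through [act_conj], so that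
    the same section serves G with the action of Q and its subextension with the
    action of P, whose module is a restricted one and not itself built from an
    outer action. *)
Section CocycleAutomorphisms.
Variables (K Q : groupType) (G : extension K Q).
Variable act : {multiplicative Q -> aut (subg (@center K))}.
Hypothesis act_conj : forall g z,
  ext_i G (subg_val (act (ext_pi G g) z)) = g * ext_i G (subg_val z) * g^-1.
Let A : hmodule Q := HModule (@ZC K) act.

Definition star_fun (l : Z1 A) (g : G) : G :=
  ext_i G (subg_val (l (ext_pi G g))) * g.

Lemma star_fun_pi l g : ext_pi G (star_fun l g) = ext_pi G g.
Proof. by rewrite gmulfM ext_pi_i mul1g. Qed.

Lemma star_fun_comp l m g : star_fun (l * m) g = star_fun l (star_fun m g).
Proof. by rewrite {2}/star_fun star_fun_pi /star_fun Z1M valM gmulfM mulgA. Qed.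

Lemma star_fun1 g : star_fun 1 g = g.
Proof. by rewrite /star_fun hom1 mul1g. Qed.

Lemma star_is_aut l : is_aut (star_fun l).
Proof.
apply/asboolP; split=> [g h|].
  rewrite /star_fun gmulfM cocycleE valM gmulfM act_conj.
  by rewrite !mulgA mulgVK.
by exists (star_fun l^-1) => g; rewrite -star_fun_comp ?mulVg ?mulgV star_fun1.
Qed.

Lemma star_in_AutE l : Aut (star_is_aut l) \in ext_aut_pred G.
Proof.
apply/ext_aut_predP; split=> [k|g]; last exact: star_fun_pi.
by rewrite /= /star_fun ext_pi_i cocycle1 hom1 mul1g.
Qed.

Definition star (l : Z1 A) : AutE G := Subg (star_in_AutE l).

Lemma starM : {morph star : l m / l * m}.
Proof. by move=> l m; apply/val_inj/aut_ext => g; exact: star_fun_comp. Qed.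

HB.instance Definition _ := isMultiplicative.Build _ _ star starM.

Lemma starE l g :
  subg_val (star l) g = ext_i G (subg_val (l (ext_pi G g))) * g.
Proof. by []. Qed.

Lemma AutE_class1P (xi : AutE G) :
  AutE_class xi = 1 <-> exists k, subg_val xi = inner (ext_i G k).
Proof.
apply: (iff_trans (qclass1P _ _)); split=> [/asboolP //|h]; exact/asboolP.
Qed.

(** If [star l] is conjugation by [k], then [k] is central because [star l]
    fixes K, and [l] is the coboundary of [k^-1]; the inverse appears because
    [k * g * k^-1 = (k * (g * k^-1 * g^-1)) * g]. *)
Lemma star_class1P l : AutE_class (star l) = 1 <-> l \in B1 A.
Proof.
apply: (iff_trans (AutE_class1P _)); split=> [[k lk]|/asboolP[a la]].
  have lE g : ext_i G (subg_val (l (ext_pi G g))) * g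
      = ext_i G k * g * (ext_i G k)^-1.
    by rewrite -starE lk.
  have kZ : k \in @center K.
    apply/asboolP => x; apply: (ext_i_inj (e := G)); rewrite !gmulfM.
    have := lE (ext_i G x); rewrite ext_pi_i cocycle1 hom1 mul1g => {2}->.
    by rewrite mulgVK.
  apply/asboolP; exists (Subg kZ)^-1 => q; have [g <-] := ext_pi_surj G q.
  apply/val_inj/(ext_i_inj (e := G))/(mulIg g).
  by rewrite lE invgK autV valM valV gmulfM homV act_conj /= !invgM invgK
             !mulgA mulgVK.
exists (subg_val a)^-1; apply/aut_ext => g.
rewrite starE la innerE valM valV gmulfM act_conj !homV invgK.
by rewrite !mulgA mulgVK.
Qed.

(** The cocycle is [g |-> xi g * g^-1], seen as a function on Q. *)
Lemma star_surj (xi : AutE G) : exists l, star l = xi.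
Proof.
have [xiK xiQ] := (ext_aut_predP (subg_val xi)).1 (subg_valP xi).
set f := subg_val xi in xiK xiQ.
have lam_ex q : exists z : subg (@center K), forall g, ext_pi G g = q ->
    f g = ext_i G (subg_val z) * g.
  have [g <-] := ext_pi_surj G q.
  have [k kE] : exists k, ext_i G k = f g * g^-1.
    by apply/ext_exact; rewrite gmulfM homV xiQ mulgV.
  (* Write x as a conjugate under g: xi fixes x, while it turns conjugation by
     g into conjugation by f g, so f g and g conjugate K in the same way. *)
  have kZ : k \in @center K.
    apply/asboolP => x; apply: (ext_i_inj (e := G)); rewrite !gmulfM.
    have : f (g * ext_i G (ext_conj g^-1 x) * g^-1) = ext_i G x.
      by rewrite ext_conjE invgK !mulgA mulgV mul1g mulgK xiK.
    rewrite !autM autV xiK ext_conjE invgK => {2}<-; rewrite kE.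
    by rewrite !mulgA mulgVK mulgK.
  exists (Subg kZ) => h hg /=.
  have [x xE] : exists x, ext_i G x = g^-1 * h.
    by apply/ext_exact; rewrite gmulfM homV hg mulVg.
  by rewrite -(mulVKg g h) -xE autM xiK kE !mulgA mulgVK.
have [lam lamE] := choice lam_ex.
have lamP : @is_cocycle _ A lam.
  apply/asboolP => q r; have [g <-] := ext_pi_surj G q.
  have [h <-] := ext_pi_surj G r.
  apply/val_inj/(ext_i_inj (e := G))/(mulIg (g * h)).
  rewrite -(lamE _ (g * h) (gmulfM g h)) autM valM gmulfM act_conj.
  by rewrite (lamE _ _ erefl) (lamE _ h erefl) !mulgA mulgVK.
exists (Cocycle lamP); apply/val_inj/aut_ext => g /=.
by rewrite /star_fun /= -lamE.
Qed.

Lemma star_on_H1 : exists s : {multiplicative H1 A -> OutK (ext_i G)},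
  injective s /\ forall l, s (qclass _ l) = AutE_class (star l).
Proof.
have [||s sE] := @factor_through _ _ _ (qclass (B1 A))
    (@AutE_class _ _ G \o star).
- by move=> c; have [l ->] := qclass_surj c; exists l.
- by move=> l /qclass1P/star_class1P.
exists s; split=> //; apply: ker_trivial_inj => c.
have [l ->] := qclass_surj c; rewrite sE => /star_class1P.
by move/qclass1P.
Qed.

End CocycleAutomorphisms.
Arguments star {K Q G act} act_conj l.
Arguments starE {K Q G act} act_conj l g.
Arguments star_on_H1 {K Q G act} act_conj.
Arguments star_surj {K Q G act} act_conj xi.

(** * Restriction of cocycles *)

Section CocycleRestriction.
Variables (H' H : groupType) (f : {multiplicative H' -> H}) (A : hmodule H).

Lemma res_cocycleM : {morph @res_cocycle _ _ f A : l m / l * m}.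
Proof. by move=> l m; apply/Z1_ext. Qed.

HB.instance Definition _ :=
  isMultiplicative.Build _ _ (@res_cocycle _ _ f A) res_cocycleM.

Lemma res_cocycle_B1 l : l \in B1 A -> res_cocycle f l \in B1 (restr_module f A).
Proof.
by move=> /asboolP[a la]; apply/asboolP; exists a => h; exact: la.
Qed.

End CocycleRestriction.

(** * Restriction to the subextension *)

Section Restriction.
Variables (K P R : groupType) (B : extension P R).
Variable theta : {multiplicative B -> Out K}.
Variables (G : extension K B) (G_theta : has_outer_action G theta).
Let N : extension K P := subextension G.
Let Theta : B -> OutK (ext_i N) := @modK_outer_action K P R B G.
Let ZK : hmodule B := center_module theta.
Let ZKP : hmodule P := restr_module (ext_i B) ZK.

Lemma center_act_conj g z :
  ext_i G (subg_val (hmod_act ZK (ext_pi G g) z))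
    = g * ext_i G (subg_val z) * g^-1.
Proof.
have -> : hmod_act ZK (ext_pi G g) = autZ (ext_conj g).
  by rewrite /= G_theta; exact: outZE.
by rewrite -ext_conjE.
Qed.

Lemma subext_center_act_conj n z :
  ext_i N (subg_val (hmod_act ZKP (ext_pi N n) z))
    = n * ext_i N (subg_val z) * n^-1.
Proof.
apply/val_inj.
have -> : hmod_act ZKP (ext_pi N n) = hmod_act ZK (ext_pi G (val n)).
  by rewrite -[ext_pi G _]subext_piE.
exact: center_act_conj.
Qed.

Let starG : Z1 ZK -> AutE G := star center_act_conj.
Let starN : Z1 ZKP -> AutE N := star subext_center_act_conj.

Lemma restr_star l : AutE_restr (starG l) = starN (res_cocycle (ext_i B) l).
Proof.
apply/val_inj/aut_ext => n; apply/val_inj.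
rewrite [LHS]starE -[ext_pi G _]subext_piE.
by [].
Qed.

(** [xi] intertwines conjugation by [g] with conjugation by [xi g], and these
    two have the same class modulo K since [xi g] and [g] agree in Q. *)
Lemma AutE_restr_compatible (xi : AutE G) :
  compatible Theta (AutE_AutK (AutE_restr xi)).
Proof.
have [_ xiQ] := (ext_aut_predP (subg_val xi)).1 (subg_valP xi).
move=> q; have [g <-] := ext_pi_surj G q.
rewrite /Theta modK_outer_actionE.
have conjE : AutE_AutK (AutE_restr xi) * subext_conj g
    = subext_conj (subg_val xi g) * AutE_AutK (AutE_restr xi).
  apply/val_inj/aut_ext => n; apply/val_inj.
  by rewrite /= !autM autV.
rewrite /commute -!gmulfM conjE !gmulfM; congr (_ * _).
transitivity (Theta (ext_pi G (subg_val xi g))).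
  exact/esym/modK_outer_actionE.
by rewrite xiQ; exact: modK_outer_actionE.
Qed.

(** Conjugation by [g] turns the factor [l p] of Z(K) into its image under the
    action of [pi g], and [n] into [g * n * g^-1], whose image in P is the
    conjugate of [p]: together they give the conjugate cocycle. *)
Lemma conj_star g l :
  subext_conj g * AutE_AutK (starN l)
    = AutE_AutK (starN (conj_cocycle (ext_pi G g) l)) * subext_conj g.
Proof.
apply/val_inj/aut_ext => n; apply/val_inj.
have conj_pi : ext_conj (ext_pi G g)^-1 (ext_pi N (val (subext_conj g) n))
    = ext_pi N n.
  apply: (ext_i_inj (e := B)).
  rewrite ext_conjE !subext_piE /= !gmulfM homV !invgK.
  by rewrite !mulgA mulVg mul1g mulgVK.
transitivity (ext_i G (subg_val (hmod_act ZK (ext_pi G g) (l (ext_pi N n))))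
    * (g * val n * g^-1)); last by rewrite -conj_pi.
by rewrite center_act_conj /= !mulgA mulgVK.
Qed.

Lemma modK_outer_action_star g l :
  Theta (ext_pi G g) * AutE_class (starN l)
    = AutE_class (starN (conj_cocycle (ext_pi G g) l)) * Theta (ext_pi G g).
Proof.
have -> : Theta (ext_pi G g) = qclass _ (subext_conj g).
  exact: modK_outer_actionE.
by rewrite /AutE_class /= -!qclassM conj_star.
Qed.

(** Commuting with [Theta (pi g)] means that [star l] and [star] of the
    conjugate of [l] by [pi g] have the same class; as [star] is injective on
    H^1, this says that the class of [l] is fixed by the image of [g] in R. *)
Lemma compatible_invariant l :
  compatible Theta (AutE_AutK (starN l)) <->
  forall r, H1_act ZK r (qclass (B1 ZKP) l) = qclass (B1 ZKP) l.
Proof.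
have [s [s_inj sE]] := star_on_H1 subext_center_act_conj.
split=> [lC r|lI q].
  have [q <-] := ext_pi_surj B r; have [g gE] := ext_pi_surj G q.
  rewrite H1_actE; apply: s_inj; rewrite !sE.
  apply: (mulIg (Theta q)); apply: (etrans _ (esym (lC q))).
  apply: esym; rewrite -gE; exact: modK_outer_action_star.
have [g <-] := ext_pi_surj G q.
apply/esym/(etrans (modK_outer_action_star g l)); congr (_ * _).
have lJ : qclass (B1 ZKP) (conj_cocycle (ext_pi G g) l) = qclass (B1 ZKP) l.
  exact: etrans (esym (H1_actE (ext_pi G g) l)) (lI _).
exact: etrans (esym (sE _)) (etrans (congr1 s lJ) (sE _)).
Qed.

End Restriction.
Arguments center_act_conj {K P R B theta G} G_theta.
Arguments subext_center_act_conj {K P R B theta G} G_theta.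
Arguments compatible_invariant {K P R B theta G} G_theta.
Arguments restr_star {K P R B theta G} G_theta.

(** * The commutative square *)

Theorem proposition8p2 (K P R : groupType) (PQR : extension P R)
  (theta : {multiplicative PQR -> Out K})
  (G : extension K PQR) (G_theta : has_outer_action G theta) :
  let N : extension K P := subextension G in
  let Theta : PQR -> OutK (ext_i N) := @modK_outer_action K P R PQR G in
  let ZK : hmodule PQR := center_module theta in
  let ZKP : hmodule P := restr_module (ext_i PQR) ZK in
  (forall xi : AutE G, compatible Theta (AutE_AutK (AutE_restr xi)))
  /\
  exists (starZG : {multiplicative Z1 ZK -> AutE G})
    (starZN : {multiplicative Z1 ZKP -> AutE N})
    (res : {multiplicative H1 ZK -> invariants (H1_module ZK)})
    (starG : {multiplicative H1 ZK -> OutE G})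
    (starN : {multiplicative invariants (H1_module ZK) -> OutTheta Theta})
    (restr : {multiplicative OutE G -> OutTheta Theta}),
  [/\ (forall (l : Z1 ZK) (g : G),
         subg_val (starZG l) g = ext_i G (subg_val (l (ext_pi G g))) * g),
      (forall (l : Z1 ZKP) (n : N),
         subg_val (starZN l) n = ext_i N (subg_val (l (ext_pi N n))) * n) &
      [/\ (forall l : Z1 ZK,
             subg_val (res (qclass _ l)) = qclass _ (res_cocycle (ext_i PQR) l)),
          (bijective starG /\
           forall l : Z1 ZK, subg_val (starG (qclass _ l)) = AutE_class (starZG l)),
          (bijective starN /\
           forall (c : invariants (H1_module ZK)) (l : Z1 ZKP),
             subg_val c = qclass _ l -> subg_val (starN c) = AutE_class (starZN l)),
          (forall (o : OutE G) (xi : AutE G),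
             subg_val o = AutE_class xi ->
             subg_val (restr o) = AutE_class (AutE_restr xi)) &
          (forall c : H1 ZK, restr (starG c) = starN (res c))]].
Proof.
move=> N Theta ZK ZKP.
split; first exact: AutE_restr_compatible.
pose sG := center_act_conj G_theta; pose sN := subext_center_act_conj G_theta.
have restr_compat (xi : AutE G) : AutE_restr xi \in compatibleE Theta.
  exact/asboolP/AutE_restr_compatible.
have resI l : qclass (B1 ZKP) (res_cocycle (ext_i PQR) l)
    \in @Defs.invariant _ (H1_module ZK).
  apply/asboolP; apply/(compatible_invariant G_theta).
  by rewrite -restr_star; exact: AutE_restr_compatible.
have restr1 (xi : AutE G) : AutE_class xi = 1 -> AutE_class (AutE_restr xi) = 1.
  move=> /AutE_class1P[k xik]; apply/AutE_class1P; exists k.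
  apply/aut_ext => n; apply/val_inj.
  by rewrite [LHS](congr1 (fun a : aut G => a (val n)) xik).
have [sGH [sGH_inj sGHE]] := star_on_H1 sG.
have [sNH [sNH_inj sNHE]] := star_on_H1 sN.
have [resQ resQE] : exists h : {multiplicative H1 ZK -> H1 ZKP},
    forall l, h (qclass _ l) = qclass _ (res_cocycle (ext_i PQR) l).
  apply: (factor_through (qclass (B1 ZK))
    (qclass (B1 ZKP) \o @res_cocycle _ _ (ext_i PQR) ZK)).
    by move=> c; have [l ->] := qclass_surj c; exists l.
  by move=> l /qclass1P lB; apply/qclass1P/res_cocycle_B1.
have [|res resE] := corestriction (@Defs.invariant _ (H1_module ZK)) resQ.
  by move=> c; have [l ->] := qclass_surj c; rewrite resQE.
have [|starG starGE] := corestriction (image_subg (@AutE_class _ _ G)) sGH.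
  move=> c; have [l ->] := qclass_surj c.
  by apply/asboolP; exists (star sG l).
have [|starN starNE] := corestriction
    (image_subg (@AutTheta_class _ _ _ N Theta))
    (sNH \o (val : invariants (H1_module ZK) -> _)).
  move=> c /=; have [l cl] := qclass_surj (val c).
  have lC : star sN l \in compatibleE Theta.
    apply/asboolP/(compatible_invariant G_theta) => r.
    by rewrite -cl; have /asboolP := valP c; exact.
  apply/asboolP; exists (Subg lC); rewrite cl sNHE //.
(* The projection of Aut(KGQ) onto its classes, through which restriction
   factors. *)
have [classG classGE] := @corestriction _ _ (image_subg (@AutE_class _ _ G))
  (@AutE_class _ _ G) (fun xi => asboolT (ex_intro _ xi erefl)).
have [|classN classNE] := corestriction
    (image_subg (@AutTheta_class _ _ _ N Theta))
    (@AutE_class _ _ N \o @AutE_restr _ _ _ _ G).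
  by move=> xi; apply/asboolP; exists (Subg (restr_compat xi)).
have [||restr restrE] := factor_through classG classN.
- move=> o; have /asboolP[xi xiE] := valP o.
  by exists xi; apply/val_inj; rewrite [LHS]classGE.
- move=> xi /(congr1 val) xi1; apply/val_inj; rewrite [LHS]classNE.
  by apply: restr1; rewrite -classGE.
exists (star sG), (star sN), res, starG, starN, restr.
split=> [||]; try exact: starE.
have starG_class l : subg_val (starG (qclass _ l)) = AutE_class (star sG l).
  by rewrite starGE.
have starN_class (c : invariants (H1_module ZK)) (l : Z1 ZKP) :
    subg_val c = qclass _ l -> subg_val (starN c) = AutE_class (star sN l).
  by move=> cl; rewrite starNE /= -sNHE -cl.
have restr_class (o : OutE G) (xi : AutE G) :
    subg_val o = AutE_class xi ->
    subg_val (restr o) = AutE_class (AutE_restr xi).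
  move=> oxi; have -> : o = classG xi by apply/val_inj; rewrite [RHS]classGE.
  by rewrite restrE classNE.
have resE' l : subg_val (res (qclass _ l)) = qclass _ (res_cocycle (ext_i PQR) l).
  by rewrite resE.
split=> //.
- split=> //; apply: bijective_inj_surj.
    move=> c d /(congr1 val) cd; apply: sGH_inj.
    by rewrite -!starGE.
  move=> o; have /asboolP[xi xiE] := valP o; have [l lE] := star_surj sG xi.
  by exists (qclass _ l); apply/val_inj; rewrite [LHS]starG_class lE.
- split=> //; apply: bijective_inj_surj.
    move=> c d /(congr1 val) cd; apply/val_inj/sNH_inj.
    by move: cd; rewrite /= !starNE.
  move=> o; have /asboolP[eta etaE] := valP o.
  have [l lE] := star_surj sN (val eta).
  have lI : qclass (B1 ZKP) l \in @Defs.invariant _ (H1_module ZK).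
    apply/asboolP/(compatible_invariant G_theta).
    have /asboolP := valP eta; rewrite -lE; exact.
  exists (Subg lI); apply/val_inj; rewrite /= (starN_class _ l) // lE //.
- move=> c; have [l ->] := qclass_surj c; apply/val_inj => /=.
  rewrite (restr_class _ (star sG l)) // (starN_class _ (res_cocycle _ l)) //.
  by rewrite restr_star.
Qed.
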